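(* Let $a,b\ge 2$ be integers with $\gcd(a,b)=1$, and let $F:=ab-a-b$. For every integer $m$, exactly one of the two equations $$ax+by=m\qquad\text{and}\qquad ax+by=F-m$$ is solvable. If additionally $-1\le m\le F+1$, then the nonnegative integral solution $(x,y)$ (of the solvable equation) is unique.
   Context: An equation in the unknowns $x,y$ is called solvable if it has a solution with $x,y$ nonnegative integers. *)

(* Defs.v *)
From mathcomp Require Import all_boot all_order all_algebra.

Set Implicit Arguments.
Unset Strict Implicit.
Unset Printing Implicit Defensive.

Import Order.TTheory GRing.Theory Num.Theory.
Local Open Scope ring_scope.

Definition nonneg_solution (a b m : int) (p : int * int) : Prop :=
  [/\ 0 <= p.1, 0 <= p.2 & a * p.1 + b * p.2 = m].

Definition solvable_eq (a b m : int) : Prop :=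
  exists p : int * int, nonneg_solution a b m p.

(* Main.v *)
Require Import Defs.
From mathcomp Require Import all_boot all_order all_algebra.
From mathcomp Require Import zify ring.

Set Implicit Arguments.
Unset Strict Implicit.
Unset Printing Implicit Defensive.

Import Order.TTheory GRing.Theory Num.Theory.
Local Open Scope ring_scope.

(** Since [a] and [b] are coprime, every integer [m] can be written as
    [m = a * x + b * y] with [0 <= x < b] and [y] of arbitrary sign
    ([reduced_representation]), and all other representations arise by moving
    multiples of [a * b] between the two terms ([representation_shift]).
    Increasing [x] decreases [y], so the reduced representation has the largest
    [y] among those with [0 <= x]: the equation is solvable exactly when the
    reduced [y] is nonnegative ([solvable_reducedP]).  The reduced
    representation of [F - m] is [a * (b - 1 - x) + b * (- 1 - y)], and exactly
    one of [y] and [- 1 - y] is nonnegative.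

    For uniqueness, both [m] and [F - m] are at most [F + 1 < a * b] in the
    given range; below [a * b] every nonnegative solution has [x < b], and two
    representations with [0 <= x < b] coincide. *)

Lemma representation_shift (a b x y x' y' : int) :
    b != 0 -> coprimez a b -> a * x + b * y = a * x' + b * y' ->
  exists k : int, x' = x + b * k /\ y' = y - a * k.
Proof.
move=> b0 cop_ab Exy.
have Eb : a * (x' - x) = b * (y - y') by lia.
have /dvdzP[k Ek] : (b %| x' - x)%Z.
  have := Gauss_dvdzr (x' - x) (_ : coprimez b a).
  rewrite coprimez_sym => <- //.
  by rewrite Eb dvdz_mulr.
exists k; split; first by lia.
have /(mulfI b0) : b * (a * k) = b * (y - y') by rewrite -Eb Ek; ring.
by lia.
Qed.

Lemma reduced_representation (a b m : int) :
    0 < b -> coprimez a b ->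
  exists x y : int, [/\ 0 <= x, x < b & a * x + b * y = m].
Proof.
move=> b_gt0 /coprimezP[[u v] /= Euv].
have b0 : b != 0 by rewrite gt_eqF.
(* Reduce modulo [b] the coefficient of [a] in [m * (u * a + v * b) = m]. *)
exists (m * u %% b)%Z, (m * v + a * (m * u %/ b)%Z); split.
- exact: modz_ge0.
- exact: ltz_pmod.
have Ediv := divz_eq (m * u) b.
rewrite -[RHS]mulr1 -Euv.
rewrite [RHS](_ : _ = a * (m * u) + b * (m * v)); last by ring.
by rewrite [in RHS]Ediv; ring.
Qed.

Lemma solvable_reducedP (a b m x y : int) :
    0 < a -> 0 < b -> coprimez a b ->
    0 <= x -> x < b -> a * x + b * y = m ->
  solvable_eq a b m <-> 0 <= y.
Proof.
move=> a_gt0 b_gt0 cop_ab x_ge0 x_ltb Em; split; last by exists (x, y).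
case=> -[x' y'] [/= x'_ge0 y'_ge0 Em'].
have b0 : b != 0 by rewrite gt_eqF.
have [k [Ex Ey]] := representation_shift b0 cop_ab (etrans Em (esym Em')).
(* [0 <= x + b * k] and [x < b] force [- 1 < k]. *)
have k_ge0 : 0 <= k by nia.
by nia.
Qed.

Lemma nonneg_solution_inj (a b m : int) (p q : int * int) :
    0 < a -> 0 < b -> coprimez a b -> m < a * b ->
  nonneg_solution a b m p -> nonneg_solution a b m q -> p = q.
Proof.
case: p q => [x y] [x' y'] a_gt0 b_gt0 cop_ab m_lt.
move=> [/= x_ge0 y_ge0 Em] [/= x'_ge0 y'_ge0 Em'].
have b0 : b != 0 by rewrite gt_eqF.
have [k [Ex Ey]] := representation_shift b0 cop_ab (etrans Em (esym Em')).
(* [a * x <= m < a * b], and likewise for [x']. *)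
have x_ltb : x < b by nia.
have x'_ltb : x' < b by nia.
have k0 : k = 0 by nia.
by rewrite Ex Ey k0 !mulr0 addr0 subr0.
Qed.

Theorem theorem1p3 (a b : int) (ha : 2 <= a) (hb : 2 <= b)
    (hab : gcdz a b = 1) (m : int) :
  let F := a * b - a - b in
  ((solvable_eq a b m /\ ~ solvable_eq a b (F - m)) \/
   (~ solvable_eq a b m /\ solvable_eq a b (F - m)))
  /\
  (-1 <= m -> m <= F + 1 ->
     (solvable_eq a b m ->
        exists! p : int * int, nonneg_solution a b m p) /\
     (solvable_eq a b (F - m) ->
        exists! p : int * int, nonneg_solution a b (F - m) p)).
Proof.
move=> F.
have a_gt0 : 0 < a by lia.
have b_gt0 : 0 < b by lia.
have cop_ab : coprimez a b by apply/eqP.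
split.
  have [x [y [x_ge0 x_ltb Em]]] := reduced_representation m b_gt0 cop_ab.
  have solm := solvable_reducedP a_gt0 b_gt0 cop_ab x_ge0 x_ltb Em.
  have EFm : a * (b - 1 - x) + b * (- 1 - y) = F - m by rewrite /F -Em; ring.
  have x1_ge0 : 0 <= b - 1 - x by lia.
  have x1_ltb : b - 1 - x < b by lia.
  have solFm := solvable_reducedP a_gt0 b_gt0 cop_ab x1_ge0 x1_ltb EFm.
  have [y_ge0 | y_lt0] := lerP 0 y; [left | right].
    by split; [apply/solm | move/solFm; lia].
  by split; [move/solm; lia | apply/solFm; lia].
move=> m_ge m_le.
have uniq n : n < a * b -> solvable_eq a b n ->
    exists! p : int * int, nonneg_solution a b n p.
  move=> n_lt [p sol_p]; exists p; split=> // q.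
  exact: nonneg_solution_inj.
by split; apply: uniq; rewrite /F in m_le *; lia.
Qed.
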